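(* Let $\mathscr{R}$ be an o-minimal expansion of $(\mathbb{R},<,+)$, let $\mathscr{N}$ be a highly saturated elementary extension of $\mathscr{R}$ with domain $N$, let $H$ be a dense independent subset of $N$, and let $\mathscr{H}$ be the structure induced on $H$ by $\mathscr{N}$. Then the Shelah expansion $\mathscr{H}^{\mathrm{Sh}}$ of $\mathscr{H}$ interprets $\mathscr{R}$.
   Context: All structures are first order. ''Definable'' means first order definable, possibly with parameters; likewise interpretations may use parameters. ''Highly saturated'' means $\kappa$-saturated for a sufficiently large cardinal $\kappa$ (in particular larger than the cardinality of the structure being extended and of its language). A subset $H$ of an o-minimal structure $\mathscr{N}$ is independent if it is independent in the sense of algebraic closure (equivalently, definable closure) in $\mathscr{N}$, i.e. no $h \in H$ lies in the algebraic closure of $H \setminus \{h\}$. ''Dense'' means dense in $N$ with respect to the order topology. For a structure $\mathscr{M}$ with domain $M$ and a set $A \subseteq M^m$, the structure induced on $A$ by $\mathscr{M}$ is the structure with domain $A$ whose primitive $n$-ary relations are all sets of the form $X \cap A^n$ for $\mathscr{M}$-definable $X \subseteq M^{nm}$. In particular, the primitive $n$-ary relations of $\mathscr{H}$ are all sets $X \cap H^n$ with $X \subseteq N^n$ definable in $\mathscr{N}$ (with parameters from $N$). For a structure $\mathscr{M}$ with domain $M$, the Shelah expansion $\mathscr{M}^{\mathrm{Sh}}$ of $\mathscr{M}$ is the structure induced on $M$ by a highly saturated elementary extension $\mathscr{M}^*$ of $\mathscr{M}$; that is, its primitive $n$-ary relations are the externally definable sets, namely the sets $X \cap M^n$ with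 $X \subseteq (M^* )^n$ definable in $\mathscr{M}^*$ with parameters from $M^*$. By saturation, the collection of externally definable sets does not depend on the choice of $\mathscr{M}^*$. Here $\mathscr{H}^{\mathrm{Sh}}$ is formed using a highly saturated elementary extension of $\mathscr{H}$. *)

(* Defs.v *)
From HB Require Import structures.
From mathcomp Require Import all_boot all_order all_algebra.
From mathcomp Require Import boolp classical_sets functions cardinality reals.

Set Implicit Arguments.
Unset Strict Implicit.
Unset Printing Implicit Defensive.

Local Open Scope classical_set_scope.

Record language := Language {
  funsym : nat -> Type;
  relsym : nat -> Type }.

Record structure (L : language) (M : Type) := Structure {
  finterp : forall n, funsym L n -> ('I_n -> M) -> M;
  rinterp : forall n, relsym L n -> ('I_n -> M) -> Prop }.

(* Free variables are the elements of an arbitrary type V. A quantifier adds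
   one variable, [None]; so [formula L (option V)] is the scope of a
   quantifier. *)
Inductive term (L : language) (V : Type) : Type :=
| tvar of V
| tapp n of funsym L n & ('I_n -> term L V).

Inductive formula (L : language) (V : Type) : Type :=
| feq of term L V & term L V
| frel n of relsym L n & ('I_n -> term L V)
| fbot
| fimp of formula L V & formula L V
| fall of formula L (option V).

Fixpoint eval (L : language) (M : Type) (S : structure L M) (V : Type)
    (v : V -> M) (t : term L V) : M :=
  match t with
  | tvar x => v x
  | tapp n f ts => finterp S f (fun i => eval S v (ts i))
  end.

Fixpoint sat (L : language) (M : Type) (S : structure L M) (V : Type)
    (v : V -> M) (p : formula L V) : Prop :=
  match p with
  | feq t u => eval S v t = eval S v u
  | frel n r ts => rinterp S r (fun i => eval S v (ts i))
  | fbot => False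
  | fimp p q => sat S v p -> sat S v q
  | fall p => forall a : M,
      sat S (fun o : option V => if o is Some x then v x else a) p
  end.

(* An L(A)-formula in the variables V is a formula over L in which each
   parameter from A occurs as an additional variable, assigned to itself. *)
Definition pformula (L : language) (M : Type) (A : set M) (V : Type) :=
  formula L (V + {a : M | A a}).

Definition psat (L : language) (M : Type) (S : structure L M) (A : set M)
    (V : Type) (v : V -> M) (p : pformula L A V) : Prop :=
  sat S (fun x => match x with inl y => v y | inr a => sval a end) p.

(* Subsets of M^V, for an index type V, definable with parameters from A. *)
Definition definable_over (L : language) (M : Type) (S : structure L M)
    (A : set M) (V : Type) (X : set (V -> M)) : Prop :=
  exists p : pformula L A V, forall v, X v <-> psat S v p.

Definition definable (L : language) (M : Type) (S : structure L M)
    (V : Type) (X : set (V -> M)) : Prop :=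
  definable_over S setT X.

Definition definable1_over (L : language) (M : Type) (S : structure L M)
    (A X : set M) : Prop :=
  definable_over S A [set v : unit -> M | X (v tt)].

(* Elementary extensions are given by elementary embeddings. *)
Definition elementary (L : language) (M M' : Type) (S : structure L M)
    (S' : structure L M') (e : M -> M') : Prop :=
  forall n (p : formula L 'I_n) (v : 'I_n -> M),
    sat S v p <-> sat S' (fun i => e (v i)) p.

Definition card_lt (T U : Type) (A : set T) (B : set U) : Prop :=
  (A #<= B)%card /\ ~ (B #<= A)%card.

(* Cardinals are represented by types K, standing for |K|. *)
Definition saturated (K : Type) (L : language) (M : Type) (S : structure L M) :
    Prop :=
  forall A : set M, card_lt A [set: K] ->
  forall q : set (pformula L A unit),
    (forall q0, finite_set q0 -> q0 `<=` q ->
       exists a : M, forall p, q0 p -> psat S (fun _ : unit => a) p) ->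
    exists a : M, forall p, q p -> psat S (fun _ : unit => a) p.

Definition symbols (L : language) : Type :=
  ({n & funsym L n} + {n & relsym L n})%type.

Definition highly_saturated_extension (L : language) (M M' : Type)
    (S : structure L M) (S' : structure L M') (e : M -> M') : Prop :=
  elementary S S' e /\
  exists K : Type, [/\ card_lt [set: M] [set: K],
    card_lt [set: symbols L] [set: K] & saturated K S'].

(* The structure induced by S on a subset of M, given as the image of an
   injection j : A -> M; the n-ary relation symbols are the traces on A^n of
   the definable subsets of M^n. *)
Definition induced_language (L : language) (M : Type) (S : structure L M)
    (A : Type) (j : A -> M) : language :=
  Language (fun _ => void)
    (fun n => {Y : set ('I_n -> A) | exists X : set ('I_n -> M),
        definable S X /\ Y = [set a | X (fun i => j (a i))]}).

Definition induced (L : language) (M : Type) (S : structure L M)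
    (A : Type) (j : A -> M) : structure (induced_language S j) A :=
  @Structure (induced_language S j) A
    (fun n (f : void) => match f with end) (fun n Y => sval Y).

(* The Shelah expansion of the L-structure on M, computed in S', which is
   meant to be a highly saturated elementary extension of it along e. *)
Definition shelah_expansion (L : language) (M M' : Type)
    (S' : structure L M') (e : M -> M') :
    structure (induced_language S' e) M :=
  induced S' e.

Definition binrel (L : language) (M : Type) (S : structure L M)
    (r : relsym L 2) (x y : M) : Prop :=
  rinterp S r (fun i => if i == ord0 then x else y).

Definition binop (L : language) (M : Type) (S : structure L M)
    (f : funsym L 2) (x y : M) : M :=
  finterp S f (fun i => if i == ord0 then x else y).

(* [None] is -oo as a left endpoint and +oo as a right endpoint. *)
Definition open_interval (M : Type) (lt : M -> M -> Prop) (a b : option M) :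
    set M :=
  [set x | (if a is Some a' then lt a' x else True) /\
           (if b is Some b' then lt x b' else True)].

Definition order_open (M : Type) (lt : M -> M -> Prop) (U : set M) : Prop :=
  forall x, U x -> exists a b : option M,
    open_interval lt a b x /\ open_interval lt a b `<=` U.

Definition order_dense (M : Type) (lt : M -> M -> Prop) (A : set M) : Prop :=
  forall U : set M, order_open lt U -> U !=set0 -> (U `&` A) !=set0.

Definition o_minimal (L : language) (M : Type) (S : structure L M)
    (lt : M -> M -> Prop) : Prop :=
  forall X : set M, definable1_over S setT X ->
  exists (P : set M) (I : set (option M * option M)),
    [/\ finite_set P, finite_set I &
        X = P `|` \bigcup_(ab in I) open_interval lt ab.1 ab.2].

Definition acl (L : language) (M : Type) (S : structure L M) (A : set M) :
    set M :=
  [set a | exists X : set M, [/\ definable1_over S A X, finite_set X & X a]].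

Definition independent (L : language) (M : Type) (S : structure L M)
    (H : set M) : Prop :=
  forall h, H h -> ~ acl S (H `\ h) h.

(* For f : M^m -> M', defined on D, the preimage of Y under the map
   D^V -> M'^V induced by f, as a subset of (M^m)^V. *)
Definition pullback (M M' : Type) (m : nat) (D : set ('I_m -> M))
    (f : ('I_m -> M) -> M') (V : Type) (Y : set (V -> M')) :
    set (V * 'I_m -> M) :=
  [set x | (forall i, D (fun k => x (i, k))) /\
           Y (fun i => f (fun k => x (i, k)))].

(* The map f identifies M' with the quotient of D by the definable equivalence
   relation f x = f y; values of f outside of D are irrelevant. *)
Definition interprets (L L' : language) (M M' : Type) (S : structure L M)
    (S' : structure L' M') : Prop :=
  exists (m : nat) (D : set ('I_m -> M)) (f : ('I_m -> M) -> M'),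
    [/\ definable S D /\ (forall y, exists2 x, D x & f x = y),
        definable S (pullback D f [set y : bool -> M' | y true = y false]),
        forall n (r : relsym L' n), definable S (pullback D f (rinterp S' r)) &
        forall n (g : funsym L' n), definable S (pullback D f
          [set y : option 'I_n -> M' |
             y None = finterp S' g (fun i => y (Some i))])].

(* Main.v *)
Require Import Defs.
From mathcomp Require Import all_boot all_order all_algebra.
From mathcomp Require Import boolp classical_sets functions cardinality reals.
From mathcomp Require Import lra.

(* The structure R is interpreted on the set D of finite elements of H, each
   representing its standard part. For closed definable X, the preimage of X is
   the limit, as h in H decreases to the positive infinitesimals, of the sets of
   tuples at distance < h from the extension of X to N; these are the fibres of
   a primitive relation of the induced structure, so by saturation the limit is
   externally definable. It remains to see that every set definable in R is a
   Boolean combination of closed definable sets. As the order is that of the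
   real numbers, this follows by induction on the dimension from Baire's
   theorem: by o-minimality with rational end points, a box covered by countably
   many definable sets has a subbox contained in one of them, hence a definable
   set X agrees with the graph of a continuous function near some point of any
   of its definable subsets of the same dimension. *)

Set Implicit Arguments.
Unset Strict Implicit.
Unset Printing Implicit Defensive.

Import Order.TTheory GRing.Theory Num.Theory.

Local Open Scope classical_set_scope.
Local Open Scope ring_scope.

(** * Formulas *)

Fixpoint tsubst L (V W : Type) (s : V -> term L W) (t : term L V) : term L W :=
  match t with
  | tvar x => s x
  | tapp n f ts => tapp f (fun i => tsubst s (ts i))
  end.

Definition slift L (V W : Type) (s : V -> term L W)
    (o : option V) :
    term L (option W) :=
  if o is Some x then tsubst (fun y => tvar L (Some y)) (s x)
  else tvar L None.

Fixpoint fsubst L (V W : Type) (s : V -> term L W) (p : formula L V) :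
    formula L W :=
  match p with
  | feq t u => feq (tsubst s t) (tsubst s u)
  | Defs.frel n r ts => Defs.frel r (fun i => tsubst s (ts i))
  | fbot => fbot L W
  | fimp p q => fimp (fsubst s p) (fsubst s q)
  | fall p => fall (fsubst (slift s) p)
  end.

Definition scons (T V : Type) (v : V -> T) (a : T) (o : option V) : T :=
  if o is Some x then v x else a.

Definition scat (T V W : Type) (v : V -> T) (w : W -> T) (x : V + W) : T :=
  match x with inl y => v y | inr z => w z end.

Lemma sat_all L M (S : structure L M) V (v : V -> M) p :
  sat S v (fall p) <-> forall a, sat S (scons v a) p.
Proof. by []. Qed.

Lemma eval_subst L M (S : structure L M) V W (s : V -> term L W) v t :
  eval S v (tsubst s t) = eval S (fun x => eval S v (s x)) t.
Proof.
elim: t => //= n f ts IH; congr finterp; apply/funext => i; exact: IH.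
Qed.

Lemma sat_subst L M (S : structure L M) V W (s : V -> term L W) v p :
  sat S v (fsubst s p) <-> sat S (fun x => eval S v (s x)) p.
Proof.
elim: p W s v => {V} /=.
- by move=> V t u W s v; rewrite !eval_subst.
- move=> V n r ts W s v.
  by under eq_fun do rewrite eval_subst.
- by [].
- by move=> V p IHp q IHq W s v; rewrite IHp IHq.
- move=> V p IH W s v.
  suff E a : (fun x => eval S (scons v a) (slift s x)) =
      scons (fun x => eval S v (s x)) a.
    by split=> h a; move: (h a); [rewrite -[X in sat _ X]/(scons _ _) IH E
      | rewrite -[X in _ -> sat _ X _]/(scons _ _) IH E].
  by apply/funext => -[x|] //=; rewrite eval_subst.
Qed.

Definition fnot L V (p : formula L V) := fimp p (fbot L V).
Definition fex L V (p : formula L (option V)) := fnot (fall (fnot p)).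
Definition frename L (V W : Type) (s : V -> W) (p : formula L V) :=
  fsubst (fun x => tvar L (s x)) p.

Lemma sat_rename L M (S : structure L M) V W (s : V -> W) v p :
  sat S v (frename s p) <-> sat S (v \o s) p.
Proof. exact: sat_subst. Qed.

Lemma sat_ex L M (S : structure L M) V (v : V -> M) p :
  sat S v (fex p) <-> exists a, sat S (scons v a) p.
Proof.
split=> [h|[a ha] h]; last exact: (h a).
by apply: contrapT => n; apply: h => a ha; apply: n; exists a.
Qed.

Definition fcons n (T : Type) (a : T) (v : 'I_n -> T) (i : 'I_n.+1) : T :=
  if unlift ord0 i is Some j then v j else a.

Lemma fcons0 n T (a : T) (v : 'I_n -> T) : fcons a v ord0 = a.
Proof. by rewrite /fcons unlift_none. Qed.

Lemma fcons_lift n T (a : T) (v : 'I_n -> T) j : fcons a v (lift ord0 j) = v j.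
Proof. by rewrite /fcons liftK. Qed.

Lemma fcons_eta n T (v : 'I_n.+1 -> T) :
  fcons (v ord0) (fun j => v (lift ord0 j)) = v.
Proof. by apply/funext => i; rewrite /fcons; case: unliftP => [j|] ->. Qed.

Lemma fcons_comp n T U (f : T -> U) a (v : 'I_n -> T) :
  (fun i => f (fcons a v i)) = fcons (f a) (fun i => f (v i)).
Proof. by apply/funext => i; rewrite /fcons; case: unlift. Qed.

(** Quantifiers bind one variable each, so a block is bound by induction on [n]. As [q] is
    independent of the structure, it can be transferred along elementary embeddings. *)
Lemma tuple_forall L V n (p : formula L (V + 'I_n)) :
  exists q : formula L V, forall M (S : structure L M) v,
    sat S v q <-> forall w : 'I_n -> M, sat S (scat v w) p.
Proof.
elim: n V p => [|n IH] V p.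
  pose g (x : V + 'I_0) : V := match x with inl y => y
    | inr i => False_rect _ (notF (ltn_ord i)) end.
  have E M (v : V -> M) w : v \o g = scat v w.
    by apply/funext => -[//|[]].
  exists (frename g p) => M S v; rewrite sat_rename; split=> [h w|h].
    by rewrite -E.
  (* The empty tuple exists in every domain, also in an empty one. *)
  case: (pselect (inhabited M)) => [[a]|nM].
    by rewrite (E _ v (fun=> a)).
  have w (i : 'I_0) : M by case: i.
  by rewrite (E _ v w).
pose g (x : V + 'I_n.+1) : option V + 'I_n :=
  match x with inl y => inl (Some y)
  | inr i => fcons (inl None) inr i end.
have [q qP] := IH _ (frename g p).
have E M (v : V -> M) a w : scat (scons v a) w \o g = scat v (fcons a w).
  by apply/funext => -[//|i] /=; rewrite /fcons; case: unlift.
exists (fall q) => M S v; split=> /= [h w|h a].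
  by have /qP/(_ (fun j => w (lift ord0 j))) := h (w ord0);
    rewrite sat_rename E fcons_eta.
by apply/qP => w; rewrite sat_rename E.
Qed.

Lemma finite_conj L V (F : finType) (p : F -> formula L V) :
  exists q : formula L V, forall M (S : structure L M) v,
    sat S v q <-> forall i, sat S v (p i).
Proof.
pose q s := foldr (fun i q => fnot (fimp (p i) (fnot q))) (fnot (fbot L V)) s.
exists (q (enum F)) => M S v.
have qP s : sat S v (q s) <-> forall i, i \in s -> sat S v (p i).
  elim: s => [|i s IH] /=; first by split.
  split=> [h j|h h1].
    apply: contrapT; rewrite inE => /not_implyP[/orP js nj]; apply: h => hi hs.
    by case: js nj => [/eqP->//|js]; apply; exact: (IH.1 hs).
  apply: h1; first by apply: h; rewrite inE eqxx.
  by apply: IH.2 => j js; apply: h; rewrite inE js orbT.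
rewrite qP; split=> h i; last by move=> _; exact: h.
by apply: h; rewrite mem_enum.
Qed.

(** The supports of the arguments are joined as a disjoint union; repetitions are harmless, as [s]
    may identify elements. *)
Lemma terms_support L V n (ts : 'I_n -> term L V) :
  (forall i, exists (F : finType) (s : F -> V) (t' : term L F),
    ts i = tsubst (fun x => tvar L (s x)) t') ->
  exists (F : finType) (s : F -> V) (us : 'I_n -> term L F),
    forall i, ts i = tsubst (fun x => tvar L (s x)) (us i).
Proof.
move=> h.
have /choice[x E] i : exists x : {F : finType & (F -> V) * term L F}%type,
    ts i = tsubst (fun y => tvar L ((tagged x).1 y)) (tagged x).2.
  have [F [s [t ->]]] := h i.
  by exists (Tagged (fun F : finType => (F -> V) * term L F)%type (s, t)).
exists {i : 'I_n & tag (x i)}, (fun y => (tagged (x (tag y))).1 (tagged y)),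
  (fun i => tsubst (fun y => tvar L (Tagged (fun i => tag (x i)) y))
    (tagged (x i)).2) => i.
rewrite {}E.
by elim: (tagged (x i)).2 => //= m g us IHu; congr tapp; apply/funext.
Qed.

Lemma term_support L V (t : term L V) :
  exists (F : finType) (s : F -> V) (t' : term L F),
    t = tsubst (fun x => tvar L (s x)) t'.
Proof.
elim: t => [x|n f ts /terms_support[F [s [us E]]]].
  by exists unit, (fun=> x), (tvar L tt).
by exists F, s, (tapp f us) => /=; congr tapp; apply/funext.
Qed.

(** Reduces an arbitrary variable type to a finite one, which can be numbered by ordinals as in
    [elementary]. *)
Lemma formula_support L V (p : formula L V) :
  exists (F : finType) (s : F -> V) (p' : formula L F),
    forall M (S : structure L M) v, sat S v p <-> sat S (v \o s) p'.
Proof.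
elim: p => {V}.
- move=> V t u; have [F [s [t' ->]]] := term_support t.
  have [G [r [u' ->]]] := term_support u.
  exists (F + G)%type, (fun x => match x with inl y => s y | inr z => r z end),
    (feq (tsubst (fun x => tvar L (inl x)) t')
         (tsubst (fun x => tvar L (inr x)) u')) => M S v.
  by rewrite /= !eval_subst.
- move=> V n r ts.
  have [F [s [us E]]] := terms_support (fun i => term_support (ts i)).
  exists F, s, (Defs.frel r us) => M S v /=.
  by under eq_fun do rewrite E eval_subst.
- move=> V; exists void, (fun x : void => match x with end), (fbot L void) => M S v.
  by [].
- move=> V p [F [s [p' IHp]]] q [G [r [q' IHq]]].
  exists (F + G)%type, (fun x => match x with inl y => s y | inr z => r z end),
    (fimp (frename inl p') (frename inr q')) => M S v.
  by rewrite /= !sat_rename IHp IHq.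
- move=> V p [F [s [p' IHp]]].
  (* The elements of [F] that [s] sends to [None] stand for the bound variable; the others support
     the quantified formula. *)
  have /choice[s' sE] (x : {x : F | isSome (s x)}) :
      exists y, s (val x) = Some y.
    by have := valP x; case: (s (val x)) => // y; exists y.
  exists {x : F | isSome (s x)}, s',
    (fall (frename (fun x => insub x : option {x : F | isSome (s x)}) p')).
  move=> M S v; rewrite !sat_all.
  suff E a : scons v a \o s =
      scons (v \o s') a \o (fun x => insub x : option {x : F | isSome (s x)}).
    by split=> h a; move: (h a); rewrite IHp sat_rename E.
  apply/funext => x /=; case: insubP => [y _ <-|]; first by rewrite sE.
  by case: (s x).
Qed.

(** With parameters treated as variables, this form also transfers formulas with parameters. *)
Lemma elementary_sat L M M' (S : structure L M) (S' : structure L M') e :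
  elementary S S' e -> forall V (p : formula L V) v,
  sat S v p <-> sat S' (e \o v) p.
Proof.
move=> he V p v; have [F [s [p' E]]] := formula_support p.
have C T (U : structure L T) (w : F -> T) :
    sat U w p' <-> sat U (w \o enum_val) (frename (@enum_rank F) p').
  rewrite sat_rename.
  suff -> : (w \o enum_val) \o @enum_rank F = w by [].
  by apply/funext => x /=; rewrite enum_rankK.
by rewrite !E !C; exact: he.
Qed.

(** * Definable sets *)

Section Definable.
Context {L : language} {M : Type} {S : structure L M}.

(** Terms are handled as functions of the assignment, so that a definability goal can be split along
    the shape of the predicate. *)
Definition definable_term (V : Type) (t : (V -> M) -> M) : Prop :=
  exists u : term L (V + {a : M | [set: M] a}),
    forall v, t v = eval S (scat v sval) u.

Lemma definable_var V (x : V) : definable_term (fun v => v x).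
Proof. by exists (tvar L (inl x)). Qed.

Lemma definable_const V (a : M) : definable_term (fun v : V -> M => a).
Proof. by exists (tvar L (inr (exist _ a I))). Qed.

Lemma definable_binop V (f : funsym L 2) (t u : (V -> M) -> M) :
  definable_term t -> definable_term u ->
  definable_term (fun v => binop S f (t v) (u v)).
Proof.
move=> [t' tE] [u' uE]; exists (tapp f (fun i => if i == ord0 then t' else u')).
move=> v; rewrite /binop tE uE /=.
by congr finterp; apply/funext => i; case: ifP.
Qed.

Lemma definable_binrel V (r : relsym L 2) (t u : (V -> M) -> M) :
  definable_term t -> definable_term u ->
  definable S (fun v => binrel S r (t v) (u v)).
Proof.
move=> [t' tE] [u' uE].
exists (Defs.frel r (fun i => if i == ord0 then t' else u')).
move=> v; rewrite /binrel tE uE /psat /=.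
by under [X in _ <-> rinterp _ _ X]eq_fun do rewrite (fun_if (eval S _)).
Qed.

Lemma definable_eq V (t u : (V -> M) -> M) :
  definable_term t -> definable_term u -> definable S (fun v => t v = u v).
Proof. by move=> [t' tE] [u' uE]; exists (feq t' u') => v; rewrite tE uE. Qed.

Lemma definable_ext V (X Y : set (V -> M)) :
  (forall v, X v <-> Y v) -> definable S X -> definable S Y.
Proof. by move=> XY [p pP]; exists p => v; rewrite -XY. Qed.

Lemma definable_subst V W (X : set (V -> M)) (t : V -> (W -> M) -> M) :
  definable S X -> (forall x, definable_term (t x)) ->
  definable S (fun w => X (fun x => t x w)).
Proof.
move=> [p pP] /choice[u uE].
exists (fsubst (scat u (fun a => tvar L (inr a))) p) => w.
rewrite pP /psat sat_subst.
suff -> : (fun x => eval S (scat w sval)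
    (scat u (fun a => tvar L (inr a)) x)) = scat (fun x => t x w) sval by [].
by apply/funext => -[x|a] /=; rewrite ?uE.
Qed.

Lemma definable_imp V (X Y : set (V -> M)) :
  definable S X -> definable S Y -> definable S (fun v => X v -> Y v).
Proof. by move=> [p pP] [q qP]; exists (fimp p q) => v; rewrite pP qP. Qed.

Lemma definable_not V (X : set (V -> M)) :
  definable S X -> definable S (fun v => ~ X v).
Proof. by move=> [p pP]; exists (fnot p) => v; rewrite pP. Qed.

Lemma definable_cst V (P : Prop) : definable S (fun _ : V -> M => P).
Proof.
have [p|np] := pselect P.
  by exists (fnot (fbot L _)) => v; split=> // _; exact: id.
by exists (fbot L _) => v; split.
Qed.

Lemma definable_and V (X Y : set (V -> M)) :
  definable S X -> definable S Y -> definable S (fun v => X v /\ Y v).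
Proof.
move=> hX hY.
apply: definable_ext (definable_not (definable_imp hX (definable_not hY))) => v.
by rewrite not_implyE notK.
Qed.

Lemma definable_or V (X Y : set (V -> M)) :
  definable S X -> definable S Y -> definable S (fun v => X v \/ Y v).
Proof.
move=> hX hY; apply: definable_ext (definable_imp (definable_not hX) hY) => v.
by split=> [h|[//|//]]; have [|n] := pselect (X v); [left|right; apply: h].
Qed.

Lemma definable_tall V n (X : (V -> M) -> ('I_n -> M) -> Prop) :
  definable S (fun w : V + 'I_n -> M =>
    X (fun x => w (inl x)) (fun i => w (inr i))) ->
  definable S (fun v => forall y, X v y).
Proof.
move=> [p pP].
pose g (x : V + 'I_n + {a : M | [set: M] a}) : V + {a | setT a} + 'I_n :=
  match x with inl (inl y) => inl (inl y) | inl (inr i) => inr i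
  | inr a => inl (inr a) end.
have [q qP] := tuple_forall (frename g p).
exists q => v; rewrite /psat qP.
have E y : X v y <-> sat S (scat (scat v sval) y) (frename g p).
  rewrite sat_rename (pP (scat v y)) /psat.
  suff -> : scat (scat v sval) y \o g = scat (scat v y) sval by [].
  by apply/funext => -[[x|i]|a].
by split=> h y; apply/E.
Qed.

Lemma definable_all V (X : (V -> M) -> M -> Prop) :
  definable S (fun w : option V -> M => X (fun x => w (Some x)) (w None)) ->
  definable S (fun v => forall a, X v a).
Proof.
move=> hX; apply: (@definable_ext _ (fun v => forall y : 'I_1 -> M, X v (y ord0))).
  by move=> v; split=> h y; [apply: (h (fun=> y))|apply: h].
apply: definable_tall.
pose t (o : option V) (w : V + 'I_1 -> M) :=
  w (if o is Some x then inl x else inr ord0).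
by apply: (definable_subst (t := t) hX) => -[x|]; exact: definable_var.
Qed.

Lemma definable_tex V n (X : (V -> M) -> ('I_n -> M) -> Prop) :
  definable S (fun w : V + 'I_n -> M =>
    X (fun x => w (inl x)) (fun i => w (inr i))) ->
  definable S (fun v => exists y, X v y).
Proof.
move=> hX; apply: (@definable_ext _ (fun v => ~ forall y, ~ X v y)).
  by move=> v; rewrite -existsNP; split=> -[y hy]; exists y => //; exact: contrapT.
by apply/definable_not/(definable_tall (X := fun v y => ~ X v y))/definable_not.
Qed.

Lemma definable_ex V (X : (V -> M) -> M -> Prop) :
  definable S (fun w : option V -> M => X (fun x => w (Some x)) (w None)) ->
  definable S (fun v => exists a, X v a).
Proof.
move=> hX; apply: (@definable_ext _ (fun v => ~ forall y, ~ X v y)).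
  by move=> v; rewrite -existsNP; split=> -[y hy]; exists y => //; exact: contrapT.
by apply/definable_not/(definable_all (X := fun v y => ~ X v y))/definable_not.
Qed.

Lemma definable_fin V (F : finType) (X : F -> set (V -> M)) :
  (forall i, definable S (X i)) -> definable S (fun v => forall i, X i v).
Proof.
move=> /choice[p pP]; have [q qP] := finite_conj p.
by exists q => v; rewrite /psat qP; split=> h i; apply/pP.
Qed.

End Definable.

(** * Baire category and definable sets of reals *)

Section Boxes.
Context {R : realType}.
Implicit Types (V : Type).

Definition box V (b : V -> R * R) : set (V -> R) :=
  fun x => forall i, (b i).1 < x i < (b i).2.

Definition closed_box V (b : V -> R * R) : set (V -> R) :=
  fun x => forall i, (b i).1 <= x i <= (b i).2.

Definition proper V (b : V -> R * R) := forall i, (b i).1 < (b i).2.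

Definition subbox V (b' b : V -> R * R) :=
  forall i, (b i).1 <= (b' i).1 /\ (b' i).2 <= (b i).2.

Lemma subbox_refl V (b : V -> R * R) : subbox b b.
Proof. by move=> i; split. Qed.

Lemma subbox_trans V (b2 b1 b3 : V -> R * R) :
  subbox b1 b2 -> subbox b2 b3 -> subbox b1 b3.
Proof. by move=> h k i; have := h i; have := k i; lra. Qed.

Lemma sub_box V (b' b : V -> R * R) : subbox b' b -> box b' `<=` box b.
Proof. by move=> h x xb i; have := h i; have := xb i; lra. Qed.

Definition shrink V (b : V -> R * R) : V -> R * R :=
  fun i => (((b i).1 *+ 2 + (b i).2) / 3, ((b i).1 + (b i).2 *+ 2) / 3).

Lemma shrinkP V (b : V -> R * R) : proper b ->
  [/\ proper (shrink b), subbox (shrink b) b & closed_box (shrink b) `<=` box b].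
Proof.
by move=> pb; split=> [i|i|x xb i]; have := pb i; rewrite /shrink /=;
  try (have := xb i; rewrite /shrink /=); lra.
Qed.

Lemma proper_box V (b : V -> R * R) : proper b -> exists x, box b x.
Proof.
by move=> pb; exists (fun i => ((b i).1 + (b i).2) / 2) => i; have := pb i; lra.
Qed.

Lemma finite_eps (F : finType) (P : F -> R -> Prop) :
  (forall i, exists2 e, 0 < e & forall e', 0 < e' <= e -> P i e') ->
  exists2 e, 0 < e & forall e' i, 0 < e' <= e -> P i e'.
Proof.
move=> /(_ _)/cid2-/all_sig[e /all_and2[e0 he]].
suff [d d0 dle] : exists2 d, 0 < d & forall i, i \in enum F -> d <= e i.
  exists d => // d' i /andP[h1 h2]; apply: he; rewrite h1 (le_trans h2) //.
  by apply: dle; rewrite mem_enum.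
elim: (enum F) => [|i s [d d0 IH]]; first by exists 1.
exists (Num.min d (e i)); first by rewrite lt_min d0 e0.
by move=> j; rewrite inE ge_min => /predU1P[->|/IH->]; rewrite ?lexx ?orbT.
Qed.

(** Coordinatewise distance less than [e], written with [<] and [+] alone so that it translates into
    the language of [RR]. *)
Definition near V (e : R) (x y : V -> R) :=
  forall i, x i < y i + e /\ y i < x i + e.

(** For finite [V], the topological closure. *)
Definition cl V (X : set (V -> R)) : set (V -> R) :=
  fun x => forall e, 0 < e -> exists y, X y /\ near e x y.

Lemma subset_cl V (X : set (V -> R)) : X `<=` cl X.
Proof. by move=> x Xx e e0; exists x; split=> // i; lra. Qed.

Lemma cl_cl V (X : set (V -> R)) : cl (cl X) `<=` cl X.
Proof.
move=> x h e e0; have [|y [hy xy]] := h (e / 2); first by lra.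
have [|z [Xz yz]] := hy (e / 2); first by lra.
by exists z; split=> // i; have := xy i; have := yz i; lra.
Qed.

Lemma box_near (V : finType) (b : V -> R * R) x : box b x ->
  exists2 e, 0 < e & forall y, near e x y -> box b y.
Proof.
move=> xb; have [|e e0 he] := @finite_eps V
    (fun i e => forall t, x i < t + e -> t < x i + e -> (b i).1 < t < (b i).2).
  move=> i; exists (Num.min (x i - (b i).1) ((b i).2 - x i)).
    by have := xb i; rewrite lt_min; lra.
  by move=> e; rewrite le_min => h t h1 h2; lra.
exists e => // y xy i; have [h1 h2] := xy i.
by apply: (he e) => //; rewrite e0 lexx.
Qed.

(** In each coordinate the supremum of the left end points works, as every left end point is at most
    every right end point. *)
Lemma nested_boxes V (B : nat -> V -> R * R) :
  (forall k, proper (B k)) -> (forall k, subbox (B k.+1) (B k)) ->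
  exists x, forall k, closed_box (B k) x.
Proof.
move=> pB nB.
have mono k m : (k <= m)%N -> subbox (B m) (B k).
  elim: m => [|m IH]; first by rewrite leqn0 => /eqP->; exact: subbox_refl.
  rewrite leq_eqVlt ltnS => /predU1P[->|/IH]; first exact: subbox_refl.
  exact/subbox_trans.
have cross i k m : (B k i).1 <= (B m i).2.
  have [hk _] := mono _ _ (leq_maxl k m) i.
  have [_ hm] := mono _ _ (leq_maxr k m) i.
  by have := pB (maxn k m) i; lra.
exists (fun i => sup [set (B k i).1 | k in [set: nat]]) => k i.
apply/andP; split.
  by apply: ub_le_sup; [exists (B 0%N i).2 => _ [m _ <-]|exists k].
by apply: ge_sup; [exists (B 0%N i).1, 0%N|move=> _ [m _ <-]].
Qed.

(** Otherwise, for each [t], every proper subbox contains a proper closed box that misses [Z t].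
    Treating all [t] in turn gives nested boxes, whose common point lies in no [Z t]. *)
Lemma baire V (T : countType) (Z : T -> set (V -> R)) (b : V -> R * R) :
  proper b -> (forall x, box b x -> exists t, Z t x) ->
  exists t b', [/\ proper b', subbox b' b & forall b'', proper b'' ->
    subbox b'' b' -> exists2 x, box b'' x & Z t x].
Proof.
move=> pb cov; apply: contrapT => n.
have /choice[step stepP] (tb : T * (V -> R * R)) : exists b'',
    proper tb.2 -> subbox tb.2 b ->
    [/\ proper b'', subbox b'' tb.2 & forall x, closed_box b'' x -> ~ Z tb.1 x].
  case: tb => t b' /=.
  have [[pb' sb']|h] := pselect (proper b' /\ subbox b' b); last first.
    by exists b' => *; case: h.
  apply: contrapT => /forallNP m; apply: n; exists t, b'; split=> // b'' pb'' sb''.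
  apply: contrapT => k; apply: (m (shrink b'')) => _ _.
  have [? s c] := shrinkP pb''; split=> //; first exact: subbox_trans sb''.
  by move=> x /c xb zx; apply: k; exists x.
(* Stage [k.+1] treats the [t] with code [k], if there is one. Starting from [shrink b] keeps the
   common point inside the open box [b]. *)
pose B := fix B k := if k is k'.+1 then
  (if unpickle k' is Some t then step (t, B k') else B k') else shrink b.
have [sp ss sc] := shrinkP pb.
have BP k : proper (B k) /\ subbox (B k) b.
  elim: k => //= k [IHp IHs]; case: unpickle => // t.
  have [? s _] := stepP (t, B k) IHp IHs.
  by split=> //; exact: subbox_trans IHs.
have [x xB] : exists x, forall k, closed_box (B k) x.
  apply: nested_boxes => k; first by case: (BP k).
  rewrite /=; case: unpickle => [t|]; last exact: subbox_refl.
  by have [p s] := BP k; case: (stepP (t, B k) p s).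
have [t Zt] := cov _ (sc _ (xB 0%N)).
have [p s] := BP (pickle t); have [_ _] := stepP (t, B (pickle t)) p s.
by move/(_ x); apply=> //; have := xB (pickle t).+1; rewrite /= pickleK.
Qed.

End Boxes.

(** * One-variable o-minimality, the dichotomy on boxes, and constructibility *)

Section RealStructure.
Context {R : realType} {L : language} {ltS : relsym L 2} {addS : funsym L 2}.
Context {RR : structure L R}.
Hypothesis RR_lt : forall x y : R, binrel RR ltS x y <-> (x < y)%R.
Hypothesis RR_add : forall x y : R, binop RR addS x y = (x + y)%R.
Hypothesis RR_omin : o_minimal RR (binrel RR ltS).

Lemma definable_add V (t u : (V -> R) -> R) :
  definable_term (S := RR) t -> definable_term (S := RR) u ->
  definable_term (S := RR) (fun v => t v + u v).
Proof.
move=> ht hu; suff -> : (fun v => t v + u v) =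
  (fun v => binop RR addS (t v) (u v)) by exact: definable_binop.
by apply/funext => v; rewrite RR_add.
Qed.

Lemma definable_lt V (t u : (V -> R) -> R) :
  definable_term (S := RR) t -> definable_term (S := RR) u ->
  definable RR (fun v => t v < u v).
Proof.
by move=> ht hu; apply: definable_ext (definable_binrel ltS ht hu) => v.
Qed.

Lemma definable_fcons V n (X : set ('I_n.+1 -> R)) (t : (V -> R) -> R)
    (u : 'I_n -> (V -> R) -> R) :
  definable RR X -> definable_term (S := RR) t ->
  (forall i, definable_term (S := RR) (u i)) ->
  definable RR (fun v => X (fcons (t v) (fun i => u i v))).
Proof.
move=> hX ht hu; apply: (definable_subst (t := fun i v =>
  fcons (t v) (fun i => u i v) i) hX) => i.
by rewrite /fcons; case: unlift.
Qed.

(** [s] lists the points of [P] and the end points of the intervals in [I]; an open interval that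
    avoids them lies inside or outside each constituent of [X]. *)
Lemma omin_const (X : set R) : definable1_over RR setT X ->
  exists s : seq R, forall l u, (forall a, a \in s -> ~ l < a < u) ->
    forall x y, l < x < u -> l < y < u -> X x -> X y.
Proof.
move=> /RR_omin[P [I [/finite_seqP[sP ->] /finite_seqP[sI ->] ->]]].
exists (sP ++ pmap fst sI ++ pmap snd sI) => l u h x y xlu ylu [/= Px|].
  by case: (h x) => //; rewrite mem_cat Px.
move=> [[a c] /= abI [/= ax xb]]; right; exists (a, c) => //=; split => /=.
  case: a abI ax => // a abI /RR_lt ax; apply/RR_lt.
  have : ~ l < a < u.
    apply: h; rewrite !mem_cat !mem_pmap; apply/orP; right; apply/orP; left.
    by apply/mapP; exists (Some a, c).
  by move=> /negP; rewrite negb_and -!leNgt => /orP[]; lra.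
case: c abI xb => // c abI /RR_lt xc; apply/RR_lt.
have : ~ l < c < u.
  apply: h; rewrite !mem_cat !mem_pmap; apply/orP; right; apply/orP; right.
  by apply/mapP; exists (a, Some c).
by move=> /negP; rewrite negb_and -!leNgt => /orP[]; lra.
Qed.

Lemma seq_gap (s : seq R) (y : R) :
  exists2 e, 0 < e & forall a, a \in s -> a <> y -> e <= `|a - y|.
Proof.
elim: s => [|c s [e e0 IH]]; first by exists 1.
have [->|/eqP cy] := eqVneq c y.
  by exists e => // a; rewrite inE => /predU1P[->|/IH].
exists (Num.min e `|c - y|).
  by rewrite lt_min e0 normr_gt0 subr_eq0; apply/eqP.
by move=> a; rewrite inE ge_min => /predU1P[->|/IH{}IH /IH ->]; rewrite ?lexx ?orbT.
Qed.

Lemma omin_local (X : set R) (y : R) : definable1_over RR setT X ->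
  exists e, [/\ 0 < e,
    (forall x, y < x < y + e -> X x) \/ (forall x, y < x < y + e -> ~ X x) &
    (forall x, y - e < x < y -> X x) \/ (forall x, y - e < x < y -> ~ X x)].
Proof.
move=> /omin_const[s hs]; have [e e0 es] := seq_gap s y; exists e.
have dich l u : (forall a, a \in s -> ~ l < a < u) ->
    (forall x, l < x < u -> X x) \/ (forall x, l < x < u -> ~ X x).
  move=> h; have [[x [xlu Xx]]|n] := pselect (exists x, l < x < u /\ X x).
    by left=> z zlu; exact: hs xlu zlu Xx.
  by right=> x xlu Xx; apply: n; exists x.
split=> //; apply: dich => a /es h alu.
- have /h : a <> y by move=> E; rewrite E in alu; lra.
  by rewrite ger0_norm; lra.
- have /h : a <> y by move=> E; rewrite E in alu; lra.
  by rewrite ler0_norm; lra.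
Qed.

Lemma rat_between (x y : R) : x < y -> exists q : rat, x < ratr q < y.
Proof. by move=> /rat_in_itvoo[q]; rewrite in_itv /=; exists q. Qed.

(** Named because Baire's theorem for definable sets in dimension [n], which follows from it, is
    used to prove it in dimension [n.+1]. *)
Definition box_dichotomy n := forall X : set ('I_n -> R), definable RR X ->
  forall b, proper b -> exists b', [/\ proper b', subbox b' b &
    box b' `<=` X \/ box b' `<=` ~` X].

(** A set dense in a box meets each of its subboxes, so of the two cases of the dichotomy only
    containment is possible. *)
Lemma baire_definable_aux n (T : countType) (Z : T -> set ('I_n -> R)) b :
  box_dichotomy n -> (forall t, definable RR (Z t)) -> proper b ->
  (forall x, box b x -> exists t, Z t x) ->
  exists t b', [/\ proper b', subbox b' b & box b' `<=` Z t].
Proof.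
move=> dich dZ pb /(baire pb)[t [b1 [pb1 sb1 dense]]].
have [b2 [pb2 sb2 [h|h]]] := dich _ (dZ t) _ pb1.
  by exists t, b2; split=> //; exact: subbox_trans sb1.
by have [x xb2 Zx] := dense _ pb2 sb2; case: (h x).
Qed.

(** Over each point of a box in dimension [n] the fibre of [X] contains or misses a rational
    interval. There are countably many of these, so Baire's theorem fixes the interval and the case
    on a whole subbox. *)
Lemma definable_box_dichotomy n : box_dichotomy n.
Proof.
elim: n => [|n IH] X dX b pb.
  have z (x y : 'I_0 -> R) : x = y by apply/funext => -[].
  exists b; split=> //.
  have [h|h] := pselect (X (fun=> 0)).
    by left=> x _; rewrite (z x (fun=> 0)).
  by right=> x _; rewrite (z x (fun=> 0)).
pose b0 := b ord0; pose bt j := b (lift ord0 j).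
(* The conditions on the end points do not involve [x]; they sit in [Z] so that they can be read off
   after the choice of [t]. *)
pose Z (t : rat * rat * bool) (x : 'I_n -> R) :=
  [/\ b0.1 <= ratr t.1.1, ratr t.1.1 < ratr t.1.2 :> R & ratr t.1.2 <= b0.2] /\
  forall a, ratr t.1.1 < a -> a < ratr t.1.2 ->
    (if t.2 then X (fcons a x) else ~ X (fcons a x)).
have dZ t : definable RR (Z t).
  case: t => -[p q] c; apply: definable_and; first exact: definable_cst.
  apply: definable_all; apply: definable_imp.
    by apply: definable_lt; [exact: definable_const|exact: definable_var].
  apply: definable_imp.
    by apply: definable_lt; [exact: definable_var|exact: definable_const].
  have d : definable RR (fun w : option 'I_n -> R =>
      X (fcons (w None) (fun i => w (Some i)))).
    by apply: definable_fcons => // *; exact: definable_var.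
  by case: c => //=; exact: definable_not.
have pbt : proper bt by move=> j; exact: pb.
have [|[[p q] c] [b' [pb' sb' /= Zb']]] := baire_definable_aux IH dZ pbt.
  move=> x xb; have : definable1_over RR setT (fun a => X (fcons a x)).
    apply: (definable_fcons (u := fun i _ => x i)) => // *.
      exact: definable_var.
    exact: definable_const.
  (* The constant germ of the fibre to the right of [b0.1] yields the rational interval. *)
  move=> /(omin_local b0.1)[e [e0 he _]].
  have lt0 : b0.1 < Num.min (b0.1 + e) b0.2.
    by rewrite lt_min; have := pb ord0; rewrite -/b0; lra.
  have [p /andP[p1 p2]] := rat_between lt0.
  have [q /andP[q1 q2]] := rat_between p2.
  move: q2; rewrite lt_min => /andP[q2 q3].
  case: he => he; [exists (p, q, true)|exists (p, q, false)];
    (split; [split=> //; exact: ltW|move=> a ? ?; apply: he; lra]).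
exists (fcons (ratr p, ratr q) b').
have [x0 /Zb'[/=[p1 p2 p3] _]] := proper_box pb'.
split.
- by move=> i; rewrite /fcons; case: unliftP => [j _|_] //; exact: pb'.
- move=> i; rewrite /fcons; case: unliftP => [j ->|->] //=.
  exact: sb'.
- have hx x : box (fcons (ratr p, ratr q) b') x ->
      [/\ ratr p < x ord0, x ord0 < ratr q & box b' (fun j => x (lift ord0 j))].
    move=> xb; split.
    + by have := xb ord0; rewrite fcons0 => /andP[].
    + by have := xb ord0; rewrite fcons0 => /andP[].
    + by move=> j; have := xb (lift ord0 j); rewrite fcons_lift.
  case: c Zb' => Zb'; [left|right] => x /hx[h1 h2 /Zb'[_ /(_ _ h1 h2)]];
    by rewrite fcons_eta.
Qed.

Lemma baire_definable n (T : countType) (Z : T -> set ('I_n -> R)) b :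
  (forall t, definable RR (Z t)) -> proper b ->
  (forall x, box b x -> exists t, Z t x) ->
  exists t b', [/\ proper b', subbox b' b & box b' `<=` Z t].
Proof. exact/baire_definable_aux/definable_box_dichotomy. Qed.


Lemma definable_at V W (X : set (V -> R)) (t : (W -> R) -> V -> R) :
  definable RR X -> (forall i, definable_term (S := RR) (fun w => t w i)) ->
  definable RR (fun w => X (t w)).
Proof. by move=> hX ht; exact: (definable_subst (t := fun i w => t w i)). Qed.

(** Splits a goal along the connectives and quantifiers of the predicate; the general substitution
    rule [definable_at] is tried last. *)
Ltac definability := repeat (cbv beta; first
  [ assumption
  | exact: definable_cst
  | exact: definable_var
  | exact: definable_const
  | apply: definable_add
  | apply: definable_lt
  | apply: definable_eq
  | apply: definable_and
  | apply: definable_imp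
  | apply: definable_not
  | apply: definable_all
  | apply: definable_ex
  | apply: definable_tall
  | apply: definable_tex
  | apply: definable_fin => ?
  | apply: definable_at => [|?] ]).

Lemma definable_cl n (X : set ('I_n -> R)) :
  definable RR X -> definable RR (cl X).
Proof. move=> dX; rewrite /cl /near; definability. Qed.


(** Coordinate [ord0] carries the radius, so that a single formula describes all neighbourhoods of
    [X]; it is later read in [NN] at radii from [H]. *)
Lemma definable_tube n (X : set ('I_n -> R)) : definable RR X ->
  definable RR (fun v : 'I_n.+1 -> R => exists y,
    X y /\ near (v ord0) (fun i => v (lift ord0 i)) y).
Proof. move=> dX; rewrite /near; definability. Qed.

(* The projection of [X] to the coordinates in [C] has nonempty interior; the
   dimension of [X] is the largest cardinality of such a [C]. *)
Definition big n (C : {set 'I_n}) (X : set ('I_n -> R)) : Prop :=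
  exists2 b, proper b & forall z, box b z ->
    exists x, X x /\ forall i, i \in C -> x i = z i.

Lemma big_sub n (C : {set 'I_n}) (X Y : set ('I_n -> R)) :
  Y `<=` X -> big C Y -> big C X.
Proof.
move=> YX [b pb h]; exists b => // z /h[x [Yx xz]].
by exists x; split=> //; exact: YX.
Qed.

(** * Fibres of a definable set over a coordinate projection *)

Section Projection.
Context {n : nat} (C : {set 'I_n}) (X : set ('I_n -> R)).
Hypothesis dX : definable RR X.

Let agree (x z : 'I_n -> R) : Prop := forall i, i \in C -> x i = z i.

Let within (J : {ffun 'I_n -> rat * rat}) (x : 'I_n -> R) : Prop :=
  forall i, i \notin C -> ratr (J i).1 < x i /\ x i < ratr (J i).2.

Lemma within_near J x : within J x ->
  exists2 e, 0 < e & forall y, near e x y -> within J y.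
Proof.
(* [J] leaves the coordinates in [C] free; they receive an interval around [x i] so that [box_near]
   applies. *)
move=> xJ; pose b i : R * R :=
  if i \in C then (x i - 1, x i + 1) else (ratr (J i).1, ratr (J i).2).
have [|e e0 he] := @box_near R _ b x.
  by move=> i; rewrite /b; case: ifPn => [_|/xJ[-> ->]] //=; lra.
exists e => // y /he yb i iC; have := yb i.
by rewrite /b (negbTE iC) => /andP.
Qed.

(** Sets over the projection to [C] are kept as sets of full tuples that depend only on the
    coordinates in [C]; [patch x z] moves [z] over the projection of [x]. *)
Let patch (x z : 'I_n -> R) i := if i \in C then x i else z i.

Let agree_patch x z : agree x (patch x z).
Proof. by move=> i iC; rewrite /patch iC. Qed.

Let unique J (z : 'I_n -> R) : Prop := forall x y,
  X x /\ agree x z /\ within J x -> X y /\ agree y z /\ within J y ->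
  forall i, x i = y i.

(* The points [z] such that the projection to the coordinate [j] of the fibre of
   [X] contains an interval are covered by countably many definable sets, none
   of which contains a box; over other [z], some rational box [J] isolates a
   point of the fibre. *)
Lemma isolate (Y : set ('I_n -> R)) : definable RR Y -> Y `<=` X ->
  big C Y -> (forall j, j \notin C -> ~ big (j |: C) X) ->
  exists J b, proper b /\ forall z, box b z ->
    (exists y, [/\ Y y, agree y z & within J y]) /\ unique J z.
Proof.
move=> dY YX [b pb bY] small.
pose Z (t : 'I_n * (rat * rat) + {ffun 'I_n -> rat * rat}) z : Prop :=
  match t with
  | inl (j, (p, q)) => (j \notin C /\ ratr p < ratr q :> R) /\
      forall a, ratr p < a -> a < ratr q -> exists x, X x /\ agree x z /\ x j = a
  | inr J => (exists y, Y y /\ agree y z /\ within J y) /\ unique J z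
  end.
have dZ t : definable RR (Z t).
  case: t => [[j [p q]]|J] /=.
    rewrite /agree; definability.
  rewrite /unique /agree /within; definability.
have [z zb|[[j [p q]]|J] [b1 [pb1 sb1 b1Z]]] := baire_definable dZ pb.
- have [y [Yy yz]] := bY z zb.
  have [[j [p [q Zjpq]]]|nZ] := pselect (exists j p q, Z (inl (j, (p, q))) z).
    by exists (inl (j, (p, q))).
  (* As the projection of the fibre to [j] contains no interval, o-minimality leaves it empty on
     both sides close to [y j]. Inside [C] the value of [J] is arbitrary. *)
  have /choice[J JP] (j : 'I_n) : exists pq : rat * rat, j \notin C ->
      [/\ ratr pq.1 < y j, y j < ratr pq.2 & forall x, X x -> agree x z ->
        ratr pq.1 < x j -> x j < ratr pq.2 -> x j = y j].
    have [jC|jC] := boolP (j \in C); first by exists (0, 0).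
    have : definable1_over RR setT (fun a => exists x, X x /\ agree x z /\ x j = a).
      rewrite /definable1_over /agree /=.
      change (definable RR (fun v : unit -> R => exists x, X x /\
        (forall i, i \in C -> x i = z i) /\ x j = v tt)).
      definability.
    move=> /(omin_local (y j))[e [e0 he1 he2]].
    have none l u : l < u -> ~ (forall a, l < a < u ->
        exists x, X x /\ agree x z /\ x j = a).
      move=> lu h; have [p /andP[lp pu]] := rat_between lu.
      have [q /andP[pq qu]] := rat_between pu; apply: nZ; exists j, p, q.
      by split=> // a pa aq; apply: h; lra.
    have [p /andP[p1 p2]] := @rat_between (y j - e) (y j) ltac:(lra).
    have [q /andP[q1 q2]] := @rat_between (y j) (y j + e) ltac:(lra).
    exists (p, q) => _ /=; split=> // x Xx xz px xq.
    case: he1 => [/none []|he1]; first by lra.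
    case: he2 => [/none []|he2]; first by lra.
    have [lt|gt|//] := ltgtP (x j) (y j).
      by case: (he2 (x j)); [lra|exists x].
    by case: (he1 (x j)); [lra|exists x].
  exists (inr (finfun J)); split.
    exists y; split=> //; split=> // j jC; rewrite ffunE.
    by case: (JP _ jC).
  have uy x : X x /\ agree x z /\ within (finfun J) x -> forall i, x i = y i.
    move=> [Xx [xz xJ]] i; have [iC|iC] := boolP (i \in C).
      by rewrite xz // yz.
    have [_ _] := JP _ iC; apply=> //.
      by have := xJ _ iC; rewrite ffunE => -[].
    by have := xJ _ iC; rewrite ffunE => -[].
  by move=> x x' /uy xy /uy x'y i; rewrite xy x'y.
- have [z0 z0b] := proper_box pb1.
  have [[jC pq] _] := b1Z _ z0b.
  case: (small j jC).
  (* The side of [b1] at [j] is replaced by the interval from [p] to [q]. Resetting coordinate [j]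
     to [z0 j] leads back into [b1] without changing the coordinates in [C]. *)
  exists (fun i => if i == j then (ratr p, ratr q) else b1 i).
    by move=> i; case: eqP.
  move=> z zb; have zj := zb j; rewrite eqxx /= in zj; case/andP: zj => zj1 zj2.
  have [] := b1Z (fun i => if i == j then z0 i else z i).
    by move=> i; have := zb i; case: eqP => // ->.
  move=> _ /(_ _ zj1 zj2)[x [Xx [xz xj]]].
  exists x; split=> // i; rewrite !inE => /predU1P[->//|iC].
  by rewrite xz //; case: eqP => // ij; rewrite -ij iC in jC.
- exists J, b1; split=> // z /b1Z[[y [Yy [yz yJ]]] un].
  by split=> //; exists y.
Qed.

(* If [x] is in [cl X] but not in [X], and lies within [J] over [z], then for
   some [j] a rational [q] separates [x j] from the value at [z] of the function
   whose graph is [X]; so [z] is in the frontier of the set [G j q c] below, and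
   the frontier of a set contains no box. *)
Lemma locally_closed_point (Y : set ('I_n -> R)) :
  definable RR Y -> Y `<=` X -> big C Y ->
  (forall j, j \notin C -> ~ big (j |: C) X) ->
  exists2 y, Y y & ~ cl (cl X `\` X) y.
Proof.
move=> dY YX bY small.
have [J [b [pb bJ]]] := isolate dY YX bY small.
pose G j (q : rat) (c : bool) z := exists y,
  (X y /\ agree y z /\ within J y) /\ (if c then y j < ratr q else ratr q < y j).
(* [Z None] holds where [X] contains all points of [cl X] that lie over [z] within [J]. *)
pose Z (t : option ('I_n * rat * bool)) z : Prop :=
  if t is Some (j, q, c) then cl (G j q c) z /\ ~ G j q c z
  else forall x, agree x z -> within J x -> cl X x -> X x.
have dG j q c : definable RR (G j q c).
  by case: c; rewrite /G /agree /within; definability.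
have dZ t : definable RR (Z t).
  case: t => [[[j q] c]|] /=.
    by have := definable_cl (dG j q c); have := dG j q c => ? ?; definability.
  by have ? := definable_cl dX; rewrite /agree /within; definability.
have [z zb|[[[j q] c]|] [b1 [pb1 sb1 b1Z]]] := baire_definable dZ pb.
- apply: contrapT => /forallNP n1; apply: (n1 None) => x xz xJ clx.
  apply: contrapT => nXx.
  have [[y [Yy yz yJ]] un] := bJ z zb.
  have Xy := YX _ Yy.
  have unz y' : X y' /\ agree y' z /\ within J y' -> forall i, y' i = y i.
    by move=> h i; exact: un.
  (* Points of [X] near [x] lie within [J] and on the same side of [q] as [x]; their projections,
     completed by [z], approach [z]. *)
  have clG j q c : (if c then x j < ratr q else ratr q < x j) -> cl (G j q c) z.
    move=> xq e e0; have [d d0 dJ] := within_near xJ.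
    have [d' d'0 d'q] : exists2 d', 0 < d' & forall t, x j < t + d' ->
        t < x j + d' -> if c then t < ratr q else ratr q < t.
      exists (`|x j - ratr q|); case: c xq => xq.
      + by rewrite ltr0_norm; lra.
      + by rewrite gtr0_norm; lra.
      + by move=> t; rewrite ltr0_norm; lra.
      + by move=> t; rewrite gtr0_norm; lra.
    have [|x' [Xx' xx']] := clx (Num.min e (Num.min d d')).
      by rewrite !lt_min e0 d0 d'0.
    have m : [/\ Num.min e (Num.min d d') <= e, Num.min e (Num.min d d') <= d &
        Num.min e (Num.min d d') <= d'].
      by split; rewrite !ge_min lexx ?orbT.
    exists (patch x' z); split.
      exists x'; split.
        split=> //; split; first exact: agree_patch.
        by apply: dJ => i; have := xx' i; case: m; lra.
      by apply: d'q; have := xx' j; case: m; lra.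
    move=> i; rewrite /patch; case: ifPn => iC; last by lra.
    by have := xx' i; rewrite xz //; case: m; lra.
  have [j xyj] : exists j, x j <> y j.
    apply: contrapT => /forallNP nj; apply: nXx.
    by have -> : x = y by apply/funext => j; apply: contrapT; exact: nj.
  have [lt|gt|//] := ltgtP (x j) (y j).
    have [q /andP[xq qy]] := rat_between lt.
    apply: (n1 (Some (j, q, true))); split; first exact: clG.
    by move=> [y' [/unz/(_ j)-> ]]; lra.
  have [q /andP[xq qy]] := rat_between gt.
  apply: (n1 (Some (j, q, false))); split; first exact: clG.
  by move=> [y' [/unz/(_ j)-> ]]; lra.
(* Close to a point of the closure of [G j q c] there are points of [G j q c] still in [b1], which
   misses that set. *)
- have [z zb] := proper_box pb1; have [d d0 db] := box_near zb.
  have [clz _] := b1Z _ zb; have [z' [Gz' zz']] := clz d d0.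
  by have [_ []] := b1Z _ (db _ zz').
(* Every point near [y] lies over [b1] and within [J], where [cl X] is contained in [X]. *)
- have [z zb] := proper_box pb1; have [d d0 db] := box_near zb.
  have [[y [Yy yz yJ]] _] := bJ _ (sub_box sb1 zb).
  have [e e0 eJ] := within_near yJ.
  exists y => // /(_ (Num.min d e)) []; first by rewrite lt_min d0 e0.
  move=> x [[clx nXx] yx]; apply: nXx.
  have m : Num.min d e <= d /\ Num.min d e <= e by rewrite !ge_min !lexx orbT.
  apply: (b1Z (patch x z)) clx.
  + apply: db => i; rewrite /patch; case: ifPn => iC; last by lra.
    by have := yx i; rewrite yz //; lra.
  + exact: agree_patch.
  + by apply: eJ => i; have := yx i; lra.
Qed.

End Projection.

(* The part of [X] where [X] is locally closed is [cl X `\` cl (cl X `\` X)]; the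
   rest of [X] has smaller dimension. *)
Lemma definable_constructible n (P : set ('I_n -> R) -> Prop) :
  (forall X, definable RR X -> cl X `<=` X -> P X) ->
  (forall X Y, P X -> P Y -> P (X `|` Y)) ->
  (forall X Y, P X -> P Y -> P (X `\` Y)) ->
  forall X, definable RR X -> P X.
Proof.
move=> Pcl PU PD.
suff main d X : definable RR X -> (forall C, big C X -> (#|C| < d)%N) -> P X.
  move=> X dX; apply: (main n.+1) => // C _.
  by rewrite ltnS (leq_trans (max_card _)) // card_ord.
(* For [d = 0] no coordinate set is [big], not even the empty one, so [X] is empty and thus
   closed. *)
elim: d X => [|d IH] X dX bX.
  apply: Pcl => // x /(_ 1 ltr01)[y [Xy _]].
  suff /bX : big finset.set0 X by [].
  exists (fun=> (0, 1)); first by move=> i; exact: ltr01.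
  by move=> z _; exists y; split=> // i; rewrite inE.
have dF : definable RR (cl X `\` X).
  by apply: definable_and; [exact: definable_cl|exact: definable_not].
have dclF := definable_cl dF.
have -> : X = (cl X `\` cl (cl X `\` X)) `|` (X `&` cl (cl X `\` X)).
  apply/seteqP; split=> x.
    move=> Xx; have [h|h] := pselect (cl (cl X `\` X) x); first by right.
    by left; split=> //; exact: subset_cl.
  move=> [[clx nx]|[]//]; apply: contrapT => nX.
  by apply: nx; apply: subset_cl.
apply: PU.
  by apply: PD; apply: Pcl; try exact: cl_cl; do ?exact: definable_cl.
apply: IH; first exact: definable_and.
move=> C bC; have bCX : big C X by apply: big_sub bC => x [].
(* If [C] has the maximal size [d], then [locally_closed_point] gives a point of the remainder
   outside the closure of [cl X] minus [X], although the remainder lies in that closure. *)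
have := bX _ bCX; rewrite ltnS leq_eqVlt => /predU1P[Cd|//]; exfalso.
have [|||j jC /bX|y [_ +]//] :=
    @locally_closed_point n C X dX (X `&` cl (cl X `\` X)).
- exact: definable_and.
- by move=> x [].
- by [].
- by rewrite cardsU1 jC Cd ltnn.
Qed.

End RealStructure.

(** * Saturation and standard parts *)

Definition eventually (P : nat -> Prop) : Prop :=
  exists k0, forall k, (k0 <= k)%N -> P k.

Lemma eventually_lt (R : realType) (x : R) : eventually (fun k => x < k%:R).
Proof.
exists (Num.truncn x).+1 => k; rewrite -(ler_nat R); apply: lt_le_trans.
exact: truncnS_gt.
Qed.

Lemma eventually_inv (R : realType) (e : R) :
  0 < e -> eventually (fun k => k.+1%:R^-1 < e).
Proof.
move=> e0; have [k0 hk] := eventually_lt e^-1; exists k0 => k /hk h.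
rewrite -[e]invrK ltf_pV2 ?posrE ?invr_gt0 ?ltr0n //.
by rewrite (lt_trans h) // ltr_nat.
Qed.

(** Finitely many formulas of [q] hold together at [u k] for large [k], so [q] is finitely
    satisfiable; a realization acts as a limit of [u]. *)
Lemma saturated_eventually K L M (S : structure L M) A
    (q : set (pformula L A unit)) (u : nat -> M) :
  saturated K S -> card_lt A [set: K] ->
  (forall p, q p -> eventually (fun k => psat S (fun=> u k) p)) ->
  exists a, forall p, q p -> psat S (fun=> a) p.
Proof.
move=> sS cA hq; apply: (sS A cA) => q0.
(* The alias [{classic _}] supplies the decidable equality behind membership in sequences of
   formulas. *)
move=> /(@finite_seqP {classic (pformula L A unit)})[s ->] sq.
suff [k hk] : exists k, forall m p, (k <= m)%N ->
    p \in (s : seq {classic (pformula L A unit)}) -> psat S (fun=> u m) p.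
  by exists (u k) => p ps; exact: hk.
elim: s sq => [|p s IH] sq; first by exists 0%N.
have [|k1 h1] := IH.
  by move=> r rs; apply: sq => /=; rewrite inE (rs : r \in s) orbT.
have [|k2 h2] := hq p; first by apply: sq; rewrite /= inE eqxx.
exists (maxn k1 k2) => m r; rewrite geq_max => /andP[m1 m2].
by rewrite inE => /predU1P[->|]; [exact: h2|exact: h1].
Qed.

Lemma card_lt_range K M M' (e : M -> M') :
  card_lt [set: M] [set: K] -> card_lt (range e) [set: K].
Proof.
move=> [h1 h2]; split; first exact: card_le_trans (card_image_le _ _) h1.
by move=> h; apply: h2; exact: card_le_trans h (card_image_le _ _).
Qed.

Lemma sat_imp L M (S : structure L M) V (v : V -> M) p q :
  sat S v (fimp p q) <-> (sat S v p -> sat S v q).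
Proof. by []. Qed.

Definition flt L (r : relsym L 2) V (x y : V) : formula L V :=
  Defs.frel r (fun i => tvar L (if i == ord0 then x else y)).

Lemma sat_flt L (r : relsym L 2) M (S : structure L M) V (v : V -> M) x y :
  sat S v (flt r x y) <-> binrel S r (v x) (v y).
Proof.
rewrite /binrel /=; suff -> : (fun i : 'I_2 => v (if i == ord0 then x else y))
  = (fun i => if i == ord0 then v x else v y) by [].
by apply/funext => i; case: ifP.
Qed.

(** * The order of [N] and standard parts *)

Section StandardPart.
Context {R : realType} {L : language} {ltS : relsym L 2}.
Context {RR : structure L R}.
Hypothesis RR_lt : forall x y : R, binrel RR ltS x y <-> (x < y)%R.
Context {N : Type} {NN : structure L N} {eN : R -> N}.
Hypothesis eN_elem : elementary RR NN eN.

Let ltN := binrel NN ltS.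

Lemma ltN_eN x y : ltN (eN x) (eN y) <-> x < y.
Proof.
have := elementary_sat eN_elem (flt ltS true false) (fun b => if b then x else y).
by rewrite !sat_flt /= RR_lt => h; exact: iff_sym.
Qed.

Lemma transfer_sentence (p : formula L void) :
  sat RR (of_void R) p -> sat NN (of_void N) p.
Proof.
move=> /(elementary_sat eN_elem).
by set w := _ \o _; suff -> : w = of_void N by [];
  apply/funext => -[].
Qed.

Lemma ltN_trans y x z : ltN x y -> ltN y z -> ltN x z.
Proof.
(* [Some (Some None)], [Some None] and [None] stand for [x], [y] and [z]: the innermost variable is
   [None]. *)
have : sat RR (of_void R) (fall (fall (fall
    (fimp (flt ltS (Some (Some None)) (Some None))
    (fimp (flt ltS (Some None) None) (flt ltS (Some (Some None)) None)))))).
  by move=> a b c /sat_flt/RR_lt h /sat_flt/RR_lt h'; apply/sat_flt/RR_lt;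
    exact: lt_trans h'.
move=> /transfer_sentence /(_ x y z) h xy yz.
pose v := scons (scons (scons (of_void N) x) y) z.
by apply/(sat_flt ltS NN v (Some (Some None)) None)/h; apply/sat_flt.
Qed.

Lemma ltN_total x y : ~ ltN x y -> ~ ltN y x -> x = y.
Proof.
have : sat RR (of_void R) (fall (fall
    (fimp (fnot (flt ltS (Some None) None))
    (fimp (fnot (flt ltS None (Some None)))
      (feq (tvar L (Some None)) (tvar L None)))))).
  move=> a b h1 h2 /=; have [lt|lt|//] := ltgtP a b.
    by case: h1; apply/sat_flt/RR_lt.
  by case: h2; apply/sat_flt/RR_lt.
move=> /transfer_sentence /(_ x y) h xy yx.
by apply: h => /sat_flt.
Qed.

Lemma ltN_asym x y : ltN x y -> ~ ltN y x.
Proof.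
have : sat RR (of_void R) (fall (fall
    (fimp (flt ltS (Some None) None) (fnot (flt ltS None (Some None)))))).
  by move=> a b /sat_flt/RR_lt h /sat_flt/RR_lt h' /=; lra.
move=> /transfer_sentence /(_ x y) h xy yx.
by apply: h; apply/sat_flt.
Qed.

Lemma ltN_dense x y : ltN x y -> exists z, ltN x z /\ ltN z y.
Proof.
have : sat RR (of_void R) (fall (fall
    (fimp (flt ltS (Some None) None) (fex (fnot
      (fimp (flt ltS (Some (Some None)) None)
        (fnot (flt ltS None (Some None))))))))).
  apply/sat_all => a; apply/sat_all => b; apply/sat_imp => /sat_flt/RR_lt ab.
  rewrite /= in ab; apply/sat_ex; exists ((a + b) / 2); apply/sat_imp => /sat_imp k.
  by apply: k; apply/sat_flt/RR_lt; rewrite /=; lra.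
move=> /transfer_sentence/sat_all/(_ x)/sat_all/(_ y)/sat_imp h xy.
have /h/sat_ex[z hz] : sat NN (scons (scons (of_void N) x) y)
  (flt ltS (Some None) None) by apply/sat_flt.
exists z; apply: contrapT => n; move/sat_imp: hz; apply.
by apply/sat_imp => /sat_flt h1 /sat_flt h2; exact: n.
Qed.

(** That [p] holds on the box is a single formula in the real parameters, the end points of the box
    among them; elementarity applies to it. *)
Lemma transfer_box n (p : formula L ('I_n + {a : R | [set: R] a}))
    (b : 'I_n -> R * R) :
  (forall v, box b v -> sat RR (scat v sval) p) ->
  forall v, (forall i, ltN (eN (b i).1) (v i) /\ ltN (v i) (eN (b i).2)) ->
  sat NN (scat v (fun a => eN (sval a))) p.
Proof.
move=> hp.
pose P := {a : R | [set: R] a}; pose c a : P := exist _ a I.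
have [q qP] := finite_conj (fun x : 'I_n * bool =>
  if x.2 then flt ltS (inr (c (b x.1).1)) (inl x.1)
  else flt ltS (inl x.1) (inr (c (b x.1).2)) : formula L ('I_n + P)).
(* The parameters become the free variables and the tuple becomes the block to be bound. *)
pose swap (x : 'I_n + P) : P + 'I_n :=
  match x with inl i => inr i | inr a => inl a end.
have [r rP] := tuple_forall (frename swap (fimp q p)).
have swapE T (v : 'I_n -> T) (w : P -> T) : scat w v \o swap = scat v w.
  by apply/funext => -[].
have /(elementary_sat eN_elem)/rP hr : sat RR sval r.
  apply/rP => v; rewrite sat_rename swapE => /qP hq; apply: hp => i.
  have /sat_flt/RR_lt := hq (i, true); have /sat_flt/RR_lt := hq (i, false).
  by move=> /= -> ->.
move=> v hv; have := hr v; rewrite sat_rename swapE; apply.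
apply/qP => -[i [|]]; apply/sat_flt; first exact: (hv i).1.
exact: (hv i).2.
Qed.

Definition finite_element (a : N) : Prop :=
  (exists r, ltN (eN r) a) /\ (exists r, ltN a (eN r)).

Definition standard_part (a : N) : R := sup [set r | ltN (eN r) a].

Lemma standard_part_lt a r :
  finite_element a -> r < standard_part a -> ltN (eN r) a.
Proof.
move=> [[s sa] [t at_]] rs.
have [|x /= xa rx] := @sup_adherent R [set r | ltN (eN r) a]
    (standard_part a - r) ltac:(lra).
  split; first by exists s.
  exists t => x /= xa; apply: ltW; apply/ltN_eN; exact: ltN_trans at_.
apply: ltN_trans xa; apply/ltN_eN; move: rx; rewrite /standard_part; lra.
Qed.

Lemma standard_part_gt a r :
  finite_element a -> standard_part a < r -> ltN a (eN r).
Proof.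
move=> [[s sa] [t at_]] rs; pose m := (standard_part a + r) / 2.
have mr : ltN (eN m) (eN r) by apply/ltN_eN; rewrite /m; lra.
have nm : ~ ltN (eN m) a.
  move=> ma; have : m <= standard_part a.
    apply: ub_le_sup => //; exists t => x /= xa; apply: ltW; apply/ltN_eN.
    exact: ltN_trans at_.
  by rewrite /m; lra.
have [am|am] := pselect (ltN a (eN m)); first exact: ltN_trans mr.
by rewrite (ltN_total am nm).
Qed.

Lemma standard_partP a y :
  (forall e, 0 < e -> ltN (eN (y - e)) a /\ ltN a (eN (y + e))) ->
  finite_element a /\ standard_part a = y.
Proof.
move=> h; have fa : finite_element a.
  by have [h1 h2] := h 1 ltr01; split; [exists (y - 1)|exists (y + 1)].
split=> //; have [lt|gt|//] := ltgtP (standard_part a) y; exfalso.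
- have e0 : 0 < (y - standard_part a) / 2 by lra.
  have [h1 _] := h _ e0; apply: (ltN_asym h1).
  by apply: standard_part_gt => //; lra.
- have e0 : 0 < (standard_part a - y) / 2 by lra.
  have [_ h1] := h _ e0; apply: (ltN_asym h1).
  by apply: standard_part_lt => //; lra.
Qed.

Context {H : set N}.
Hypothesis H_dense : order_dense (binrel NN ltS) H.

Lemma H_between a c : ltN a c ->
  exists h : {x | H x}, ltN a (sval h) /\ ltN (sval h) c.
Proof.
move=> ac; have [||h [hac hH]] :=
    @H_dense (open_interval (binrel NN ltS) (Some a) (Some c)).
- by move=> x xac; exists (Some a), (Some c); split=> // ?.
- by have [z hz] := ltN_dense ac; exists z.
- by exists (exist _ h hH).
Qed.

(** Saturation of [NN] supplies [a] infinitesimally above [eN y]; density supplies an element of [H]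
    between [eN y] and [a]. *)
Lemma standard_part_surj K : saturated K NN -> card_lt [set: R] [set: K] ->
  forall y, exists h : {x | H x},
    finite_element (sval h) /\ standard_part (sval h) = y.
Proof.
move=> sN cR y.
have cA := card_lt_range eN cR.
pose c r : {a | range eN a} := exist _ (eN r) (imageT eN r).
pose q : set (pformula L (range eN) unit) := fun p =>
  p = flt ltS (inr (c y)) (inl tt) \/
  exists2 e, 0 < e & p = flt ltS (inl tt) (inr (c (y + e))).
have [p|a ha] := @saturated_eventually K L N NN _ q
    (fun k => eN (y + k.+1%:R^-1)) sN cA.
  case=> [->|[e e0 ->]].
    exists 0%N => k _; apply/sat_flt/ltN_eN.
    by rewrite ltrDl invr_gt0 ltr0n.
  have [k0 hk] := eventually_inv e0; exists k0 => k /hk h.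
  by apply/sat_flt/ltN_eN; rewrite ltrD2l.
have ya : ltN (eN y) a by have /sat_flt := ha _ (or_introl erefl).
have [h [yh hA]] := H_between ya; exists h; apply: standard_partP => e e0.
split; first by apply: ltN_trans yh; apply/ltN_eN; lra.
apply: ltN_trans hA _.
by have /sat_flt := ha _ (or_intror (ex_intro2 _ _ e e0 erefl)).
Qed.

End StandardPart.

(** * Externally definable sets *)

Section ExternallyDefinable.
Context {L : language} {N : Type} {NN : structure L N} {HT : Type} {j : HT -> N}.
Context {Hstar : Type} {HHstar : structure (induced_language NN j) Hstar}.
Context {eH : HT -> Hstar}.
Hypothesis eH_elem : elementary (induced NN j) HHstar eH.
Context {K : Type}.
Hypothesis HHstar_sat : saturated K HHstar.
Hypothesis card_HT : card_lt [set: HT] [set: K].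

Definition induced_symbol n (E : set ('I_n -> N)) (dE : definable NN E) :
    relsym (induced_language NN j) n :=
  exist _ [set a | E (fun i => j (a i))] (ex_intro _ E (conj dE erefl)).

Lemma induced_symbolP n (E : set ('I_n -> N)) (dE : definable NN E) a :
  rinterp HHstar (induced_symbol dE) (fun i => eH (a i)) <->
  E (fun i => j (a i)).
Proof.
apply: iff_sym.
exact: (eH_elem (Defs.frel (induced_symbol dE) (fun i => tvar _ i)) a).
Qed.

Lemma definable_external V n (g : 'I_n -> V) (Y : set ('I_n -> Hstar)) :
  definable HHstar Y ->
  definable (shelah_expansion HHstar eH)
    (fun x : V -> HT => Y (fun i => eH (x (g i)))).
Proof.
move=> dY.
pose r : relsym (induced_language HHstar eH) n :=
  exist _ [set a | Y (fun i => eH (a i))] (ex_intro _ Y (conj dY erefl)).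
by exists (Defs.frel r (fun i => tvar _ (inl (g i)))) => v.
Qed.

(* By saturation, a limit of the fibres of a relation definable in [NN] is
   again a fibre, at a point of [Hstar]. *)
Lemma external_limit n (E : set ('I_n.+1 -> N)) (u : nat -> HT)
    (D G : set ('I_n -> HT)) :
  definable NN E ->
  (forall a, D a -> G a ->
    eventually (fun k => E (fcons (j (u k)) (fun i => j (a i))))) ->
  (forall a, D a -> ~ G a ->
    eventually (fun k => ~ E (fcons (j (u k)) (fun i => j (a i))))) ->
  exists Y : set ('I_n -> Hstar), definable HHstar Y /\
    forall a, D a -> (G a <-> Y (fun i => eH (a i))).
Proof.
move=> dE GE nGE; pose r := induced_symbol dE.
pose c h : {x | range eH x} := exist _ (eH h) (imageT eH h).
pose phi (a : 'I_n -> HT) : pformula _ (range eH) unit :=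
  Defs.frel r (fun i => tvar _ (fcons (inl tt) (fun i => inr (c (a i))) i)).
have phiP b a : psat HHstar (fun=> b) (phi a) <->
    rinterp HHstar r (fcons b (fun i => eH (a i))).
  rewrite /psat /phi /=; set w := (X in rinterp _ _ X).
  suff -> : w = fcons b (fun i => eH (a i)) by [].
  by apply/funext => i; rewrite /w /fcons; case: unlift.
have phiu k a : psat HHstar (fun=> eH (u k)) (phi a) <->
    E (fcons (j (u k)) (fun i => j (a i))).
  by rewrite phiP -!fcons_comp induced_symbolP.
(* The type of a point whose fibre agrees with [G] on [D]; each of its formulas eventually holds
   along [u]. *)
pose q : set (pformula (induced_language NN j) (range eH) unit) := fun p =>
  exists a, D a /\ (G a /\ p = phi a \/ ~ G a /\ p = fnot (phi a)).
have [_ [a [Da [[Ga ->]|[nGa ->]]]]|b bq] := @saturated_eventually K _ _ HHstar _ q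
    (fun k => eH (u k)) HHstar_sat (card_lt_range eH card_HT).
- by have [k0 hk] := GE a Da Ga; exists k0 => k /hk ?; apply/phiu.
- by have [k0 hk] := nGE a Da nGa; exists k0 => k /hk ? /phiu.
exists (fun y => rinterp HHstar r (fcons b y)); split.
  pose t (i : 'I_n.+1) (y : 'I_n -> Hstar) := fcons b y i.
  apply: (definable_subst (t := t)) => [|i]; last first.
    rewrite /t /fcons; case: unlift => [i'|]; first exact: definable_var.
    exact: definable_const.
  by exists (Defs.frel r (fun i => tvar _ (inl i))).
move=> a Da; rewrite -phiP; split=> [Ga|h].
  by apply: bq; exists a; split=> //; left.
apply: contrapT => nGa; have : psat HHstar (fun=> b) (fnot (phi a)).
  by apply: bq; exists a; split=> //; right.
exact.
Qed.

End ExternallyDefinable.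

(** * The interpretation *)

Section Interpretation.
Context {R : realType} {L : language} {ltS : relsym L 2} {addS : funsym L 2}.
Context {RR : structure L R}.
Hypothesis RR_lt : forall x y : R, binrel RR ltS x y <-> (x < y)%R.
Hypothesis RR_add : forall x y : R, binop RR addS x y = (x + y)%R.
Hypothesis RR_omin : o_minimal RR (binrel RR ltS).
Context {N : Type} {NN : structure L N} {eN : R -> N}.
Hypothesis eN_elem : elementary RR NN eN.
Context {H : set N}.
Hypothesis H_dense : order_dense (binrel NN ltS) H.

Let HT := {x : N | H x}.

Context {Hstar : Type}.
Context {HHstar : structure
  (induced_language NN (fun h : {x : N | H x} => sval h)) Hstar}.
Context {eH : {x : N | H x} -> Hstar}.
Hypothesis eH_elem :
  elementary (induced NN (fun h : {x : N | H x} => sval h)) HHstar eH.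
Context {K : Type}.
Hypothesis HHstar_sat : saturated K HHstar.
Hypothesis card_HT : card_lt [set: {x : N | H x}] [set: K].

Let ltN := binrel NN ltS.
Let S := shelah_expansion HHstar eH.
Let fin (h : HT) : Prop := finite_element (ltS := ltS) (NN := NN) (eN := eN) (sval h).
Let st (h : HT) : R := standard_part (ltS := ltS) (NN := NN) (eN := eN) (sval h).

Lemma H_sequence (l r : nat -> R) : (forall k, l k < r k) ->
  exists u : nat -> HT,
    forall k, ltN (eN (l k)) (sval (u k)) /\ ltN (sval (u k)) (eN (r k)).
Proof.
move=> lr; have /choice[u hu] : forall k, exists h : HT,
    ltN (eN (l k)) (sval h) /\ ltN (sval h) (eN (r k)).
  by move=> k; apply: (H_between RR_lt eN_elem H_dense); apply/(ltN_eN RR_lt eN_elem).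
by exists u.
Qed.

(** An element is bounded below by a real if it is eventually above a sequence in [H] that descends
    past all reals; upper bounds are symmetric. [external_limit] makes both conditions externally
    definable. *)
Lemma definable_fin_elements V (w : V) :
  definable S (fun x : V -> HT => fin (x w)).
Proof.
have ltT := ltN_trans RR_lt eN_elem.
have ltE := ltN_eN RR_lt eN_elem.
apply: definable_and.
- have [k|u hu] := @H_sequence (fun k => - k%:R - 1) (fun k => - k%:R); first by lra.
  have [|||Y [dY YP]] := @external_limit _ _ _ _ _ _ _ _ eH_elem _ HHstar_sat card_HT 1
    (fun v => ltN (v ord0) (v (lift ord0 ord0))) u setT
    (fun a => exists r, ltN (eN r) (sval (a ord0))).
  + by apply: definable_binrel; exact: definable_var.
  + move=> a _ [r ra]; have [k0 hk] := eventually_lt (- r); exists k0 => k /hk h.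
    rewrite fcons0 fcons_lift; apply: (ltT _ _ _ _ ra); apply: (ltT _ _ _ (hu k).2).
    by apply/ltE; lra.
  + move=> a _ na; exists 0%N => k _; rewrite fcons0 fcons_lift => ua; apply: na.
    by exists (- k%:R - 1); exact: (ltT _ _ _ (hu k).1 ua).
  apply: definable_ext (definable_external (fun=> w) dY) => x.
  by rewrite -(YP (fun=> x w) I).
- have [k|u hu] := @H_sequence (fun k => k%:R) (fun k => k%:R + 1); first by lra.
  have [|||Y [dY YP]] := @external_limit _ _ _ _ _ _ _ _ eH_elem _ HHstar_sat card_HT 1
    (fun v => ltN (v (lift ord0 ord0)) (v ord0)) u setT
    (fun a => exists r, ltN (sval (a ord0)) (eN r)).
  + by apply: definable_binrel; exact: definable_var.
  + move=> a _ [r ra]; have [k0 hk] := eventually_lt r; exists k0 => k /hk h.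
    rewrite fcons0 fcons_lift; apply: (ltT _ _ _ ra); apply: (ltT _ _ _ _ (hu k).1).
    exact/ltE.
  + move=> a _ na; exists 0%N => k _; rewrite fcons0 fcons_lift => ua; apply: na.
    by exists (k%:R + 1); exact: (ltT _ _ _ ua (hu k).2).
  apply: definable_ext (definable_external (fun=> w) dY) => x.
  by rewrite -(YP (fun=> x w) I).
Qed.

Let D : set ('I_1 -> HT) := fun a => fin (a ord0).
Let f (a : 'I_1 -> HT) : R := st (a ord0).

(** If the standard parts form a point of [X], the tuple lies in the tube of every radius [u k].
    Otherwise closedness keeps [X] at a positive real distance from that point, and tubes of small
    radius miss the tuple. *)
Lemma definable_pullback_closed n (X : set ('I_n -> R)) :
  definable RR X -> cl X `<=` X -> definable S (pullback D f X).
Proof.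
move=> dX clX.
have [p pP] := definable_tube RR_lt RR_add dX.
pose c (a : {a : R | [set: R] a}) := eN (sval a).
(* The formula for the tube read in [NN], its real parameters moved along [eN]. *)
pose E : set ('I_n.+1 -> N) := fun v => sat NN (scat v c) p.
have dE : definable NN E.
  exists (frename (fun x => match x with inl i => inl i
    | inr a => inr (exist _ (c a) I) end) p) => v.
  rewrite /psat sat_rename /E; set w := (X in _ <-> sat _ X _).
  by suff -> : scat v c = w by []; apply/funext => -[].
(* The radii are taken from [H]; confining them between consecutive reciprocals makes [transfer_box]
   applicable. *)
have k0 (k : nat) : k.+2%:R^-1 < k.+1%:R^-1 :> R.
  by rewrite ltf_pV2 ?posrE ?ltr0n // ltr_nat.
have [u hu] := @H_sequence (fun k => k.+2%:R^-1) (fun k => k.+1%:R^-1) k0.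
have box_st e (a : 'I_n -> HT) i : 0 < e -> fin (a i) ->
    ltN (eN (st (a i) - e)) (sval (a i)) /\ ltN (sval (a i)) (eN (st (a i) + e)).
  move=> e0 fa; split.
    by apply: (standard_part_lt RR_lt eN_elem) => //; rewrite -/(st _); lra.
  by apply: (standard_part_gt RR_lt eN_elem) => //; rewrite -/(st _); lra.
(* The formula [p'] holds on [NN] wherever it holds on a real box around the
   standard parts. *)
have transfer (p' : formula L ('I_n.+1 + {a : R | [set: R] a})) k a e :
    0 < e -> (forall i, fin (a i)) ->
    (forall h v, k.+2%:R^-1 < h < k.+1%:R^-1 -> near e (fun i => st (a i)) v ->
      sat RR (scat (fcons h v) sval) p') ->
    sat NN (scat (fcons (sval (u k)) (fun i => sval (a i))) c) p'.
  move=> e0 fa hp; apply: (transfer_box RR_lt eN_elem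
    (b := fcons (k.+2%:R^-1, k.+1%:R^-1) (fun i => (st (a i) - e, st (a i) + e)))).
    move=> v vb; rewrite -[v]fcons_eta; apply: hp.
      by have := vb ord0; rewrite fcons0.
    move=> i; have := vb (lift ord0 i).
    by rewrite fcons_lift /= => /andP[? ?]; split; lra.
  move=> i; rewrite /fcons; case: unliftP => [i' _|_] /=; last exact: hu.
  exact: box_st.
have [||Y [dY YP]] := @external_limit _ _ _ _ _ _ _ _ eH_elem _ HHstar_sat card_HT n
    E u (fun a => forall i, fin (a i)) (fun a => X (fun i => st (a i))) dE.
(* Half-width [k.+2%:R^-1] is below every admissible radius [h], so the standard point itself is a
   witness. *)
- move=> a fa Xa; exists 0%N => k _; apply: (transfer _ _ _ k.+2%:R^-1) => //.
    by rewrite invr_gt0 ltr0n.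
  move=> h v hh av; apply/pP; exists (fun i => st (a i)); split=> // i.
  rewrite fcons0 fcons_lift; move: hh (av i) => /andP[+ _] /=.
  by move: (k.+2%:R^-1) => d; lra.
- move=> a fa nXa.
  have [e e0 he] : exists2 e, 0 < e & forall y, X y -> ~ near e (fun i => st (a i)) y.
    apply: contrapT => n1; apply: nXa; apply: clX => e e0.
    apply: contrapT => n2; apply: n1; exists e => // y Xy yn; apply: n2.
    by exists y.
  (* One half of [e] covers the distance from the standard point to [v], the other bounds the radius
     [h]. *)
  have e20 : 0 < e / 2 by lra.
  have [k1 hk1] := eventually_inv e20; exists k1 => k /hk1 hk.
  suff : sat NN (scat (fcons (sval (u k)) (fun i => sval (a i))) c) (fnot p) by [].
  apply: (transfer _ _ _ (e / 2)) => // h v hh av.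
  move=> /pP[y [Xy]]; rewrite fcons0 => vy; apply: (he y Xy) => i.
  have := vy i; have := av i; move: hh hk => /andP[_ +] /=; rewrite fcons_lift.
  by move: (k.+1%:R^-1) => d; lra.
pose g (i : 'I_n) : 'I_n * 'I_1 := (i, ord0).
have dfin : definable S (fun x : 'I_n * 'I_1 -> HT => forall i, fin (x (g i))).
  by apply: definable_fin => i; exact: definable_fin_elements.
apply: definable_ext (definable_and dfin (definable_external g dY)) => x.
by split=> -[fx]; have h := YP (fun i => x (g i)) fx; split=> //; apply/h.
Qed.

(** The index types in [interprets] are renumbered by ordinals. Pullback commutes with unions and
    differences, which reduces the claim to closed sets. *)
Lemma definable_pullback (W : finType) (X : set (W -> R)) :
  definable RR X -> definable S (pullback D f X).
Proof.
move=> dX; pose X' (v : 'I_#|W| -> R) := X (fun w => v (enum_rank w)).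
have dX' : definable RR X'.
  by apply: (definable_at (t := fun v w => v (enum_rank w)) dX) => w;
    exact: definable_var.
have : definable S (pullback D f X').
  apply: (definable_constructible RR_lt RR_add RR_omin
    (P := fun Z => definable S (pullback D f Z))) dX'.
  - exact: definable_pullback_closed.
  - move=> Y Z dY dZ; apply: definable_ext (definable_or dY dZ) => x.
    by split=> [[[? ?]|[? ?]]|[? [?|?]]]; [split=> //; left|split=> //; right|left|right].
  - move=> Y Z dY dZ; apply: definable_ext (definable_and dY (definable_not dZ)) => x.
    split=> [[[Dx Yx] nZ]|[Dx [Yx nZ]]]; last by split=> // -[].
    by split=> //; split=> // Zx; apply: nZ.
pose t (x : 'I_#|W| * 'I_1) (v : W * 'I_1 -> HT) := v (enum_val x.1, x.2).
move=> /(definable_subst (t := t))/(_ (fun x => definable_var _)).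
apply: definable_ext => x; split=> -[Dx Xx]; split.
- by move=> w; have := Dx (enum_rank w); rewrite /t /= enum_rankK.
- by move: Xx; rewrite /X' /t /=; under eq_fun do rewrite enum_rankK.
- by move=> i; exact: (Dx (enum_val i)).
- by rewrite /X' /t /=; under eq_fun do rewrite enum_rankK.
Qed.

Lemma shelah_interprets :
  (forall y, exists h : HT, fin h /\ st h = y) -> interprets S RR.
Proof.
move=> st_surj; exists 1%N, D, f; split.
- split; first exact: definable_fin_elements.
  by move=> y; have [h [fh hy]] := st_surj y; exists (fun=> h).
- by apply: definable_pullback; apply: definable_eq; exact: definable_var.
- move=> n r; apply: definable_pullback.
  by exists (Defs.frel r (fun i => tvar _ (inl i))).
- move=> n g; apply: definable_pullback.
  by exists (feq (tvar _ (inl None)) (tapp g (fun i => tvar _ (inl (Some i))))).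
Qed.

End Interpretation.

Theorem proposition3p4
  (R : realType) (L : language) (ltS : relsym L 2) (addS : funsym L 2)
  (RR : structure L R)
  (RR_lt : forall x y : R, binrel RR ltS x y <-> (x < y)%R)
  (RR_add : forall x y : R, binop RR addS x y = (x + y)%R)
  (RR_omin : o_minimal RR (binrel RR ltS))
  (N : Type) (NN : structure L N) (eN : R -> N)
  (NN_ext : highly_saturated_extension RR NN eN)
  (H : set N)
  (H_dense : order_dense (binrel NN ltS) H)
  (H_indep : independent NN H)
  (Hstar : Type)
  (HHstar : structure
     (induced_language NN (fun h : {x : N | H x} => sval h)) Hstar)
  (eH : {x : N | H x} -> Hstar)
  (HHstar_ext : highly_saturated_extension
     (induced NN (fun h : {x : N | H x} => sval h)) HHstar eH) :
  interprets (shelah_expansion HHstar eH) RR.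
Proof.
have [eN_elem [K [card_R _ NN_sat]]] := NN_ext.
have [eH_elem [K' [card_H _ HHstar_sat]]] := HHstar_ext.
(* Saturation of [HHstar] gives definability in the Shelah expansion; that of [NN] makes every real
   the standard part of an element of [H]. *)
apply: (shelah_interprets RR_lt RR_add RR_omin eN_elem H_dense eH_elem
  HHstar_sat card_H).
exact: (standard_part_surj RR_lt eN_elem H_dense NN_sat card_R).
Qed.
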